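(* Let $d\in\mathbb N$ be an odd number, and let $D$ be the unitary diagonal matrix $$D=\mathrm{diag}\left(1,q,q^3,\dots,q^{\frac{j(j+1)}{2}},\dots,1\right)\qquad (j=0,1,\dots,d-1).$$ Then: (i) The matrices $V_k$, $k\in F_d$, are all unitarily equivalent to $U$. (ii) Let $P_k:=D^{-k}P_0$. Then for all $k\in F_d$ one has $P_k^*V_kP_k=U$. In other words, if $P_0=(v_0,v_1,\dots,v_{d-1})$ (written by columns), then, by columns, $$P_k^*=\left(v_0,\,q^kv_{d-1},\dots,q^{kj(j+1)/2}v_{d-j},\dots,v_1\right).$$ (iii) For all $k\in F_d$ such that $d$ and $k$ are coprime, $|\mathrm{Tr}\,D^k|=\sqrt d$.
   Context: Rows and columns of $d\times d$ matrices are indexed by $\{0,1,\dots,d-1\}$, and $q=\exp(2i\pi/d)$. $F_d=\mathbb Z/d\mathbb Z$ denotes the residues modulo $d$, represented by $\{0,1,\dots,d-1\}$. $U=\mathrm{diag}(1,q,q^2,\dots,q^{d-1})$. $V$ is the matrix with $V_{j,j+1}=1$ for $0\le j\le d-2$, $V_{d-1,0}=1$ and all other entries $0$. $V_k:=VU^k$. $P_0$ is the matrix with entries $(P_0)_{j,k}=d^{-1/2}q^{jk}$. *)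

(* Defs.v *)
From HB Require Import structures.
From mathcomp Require Import all_boot all_order all_algebra.
From mathcomp Require Import spectral.
From mathcomp Require Import boolp reals sequences exp trigo.
From mathcomp Require Import complex.

Set Implicit Arguments.
Unset Strict Implicit.
Unset Printing Implicit Defensive.

Import Order.TTheory GRing.Theory Num.Theory.
Local Open Scope ring_scope.
Local Open Scope complex_scope.
Local Open Scope sesquilinear_scope.

Definition Cexp (R : realType) (z : R[i]) : R[i] :=
  let: x +i* y := z in (expR x)%:C * (cos y +i* sin y).

Definition sqrtd (R : realType) (d : nat) : R[i] := (Num.sqrt (d%:R : R))%:C.

Definition q (R : realType) (d : nat) : R[i] :=
  Cexp (2 * 'i%C * (pi : R)%:C / d%:R).

Definition U (R : realType) (d : nat) : 'M[R[i]]_d :=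
  diag_mx (\row_(j < d) q R d ^+ j).

(* The second case is the corner entry at row d - 1, column 0. *)
Definition V (R : realType) (d : nat) : 'M[R[i]]_d :=
  \matrix_(i < d, j < d)
    if (j == i.+1 :> nat) || ((i.+1 == d) && (j == 0 :> nat)) then 1 else 0.

Definition Vk (R : realType) (d : nat) (k : 'I_d) : 'M[R[i]]_d :=
  V R d *m U R d ^+ k.

Definition P0 (R : realType) (d : nat) : 'M[R[i]]_d :=
  \matrix_(j < d, k < d) ((sqrtd R d)^-1 * q R d ^+ (j * k)).

Definition D (R : realType) (d : nat) : 'M[R[i]]_d :=
  diag_mx (\row_(j < d) q R d ^+ ((j * j.+1) %/ 2)).

(* [invmx A] is [A] itself when [A] is singular; [D] is always invertible. *)
Definition Pk (R : realType) (d : nat) (k : 'I_d) : 'M[R[i]]_d :=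
  invmx (D R d) ^+ k *m P0 R d.

Definition unitarily_equivalent (R : realType) (d : nat) (A B : 'M[R[i]]_d) :=
  exists2 W : 'M[R[i]]_d, W \is unitarymx & W^t* *m A *m W = B.

(* Main.v *)
(* With t(j) = q^(j(j+1)/2), one has t(l + m) = t(l) t(m) q^(lm), and for odd d
   the function t is d-periodic since d divides d(d+1)/2. The case m = 1 says
   that D^k V_k D^-k = V, and V P_0 = P_0 U because the columns of the unitary
   matrix P_0 are eigenvectors of the shift V. Summing t(l + m)^k / t(l)^k over
   l and m gives |Tr D^k|^2, in which only the terms with m = 0 survive. *)

Require Import Defs.
From mathcomp Require Import all_boot all_order all_algebra.
From mathcomp Require Import spectral.
From mathcomp Require Import boolp reals sequences exp trigo.
From mathcomp Require Import complex.
From mathcomp Require Import zify lra.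

Set Implicit Arguments.
Unset Strict Implicit.
Unset Printing Implicit Defensive.

Import Order.TTheory GRing.Theory Num.Theory.
Local Open Scope ring_scope.
Local Open Scope complex_scope.
Local Open Scope sesquilinear_scope.

(** * Arithmetic of the triangular exponents j(j+1)/2 *)

Lemma triangleD m n :
  (((m + n) * (m + n).+1) %/ 2 = (m * m.+1) %/ 2 + (n * n.+1) %/ 2 + m * n)%N.
Proof.
(* One of two consecutive integers is even, so the truncating division is exact. *)
have T k : ((k * k.+1) %/ 2 * 2 = k * k.+1)%N.
  by apply: divnK; rewrite dvdn2 oddM /= andbN.
have := (T m, T n, T (m + n)%N) => -[[? ?] ?]; nia.
Qed.

(** The exponent in the last diagonal entry of [D] is thus a multiple of d, which makes that entry
    1. *)
Lemma triangle_pred d :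
  odd d -> ((d.-1 * d.-1.+1) %/ 2 = d * (d.-1 %/ 2))%N.
Proof.
move=> d_odd; rewrite prednK ?odd_gt0 // mulnC.
by rewrite muln_divA // dvdn2; case: d d_odd.
Qed.

Lemma triangle_odd d : odd d -> ((d * d.+1) %/ 2 = d * (d.+1 %/ 2))%N.
Proof. by move=> d_odd; rewrite muln_divA // dvdn2 /= d_odd. Qed.

(** * Powers and unitarity of diagonal matrices *)

Lemma diag_mxX (K : pzSemiRingType) n (v : 'rV[K]_n) k :
  diag_mx v ^+ k = diag_mx (\row_j v 0 j ^+ k).
Proof.
elim: k => [|k IHk].
  by rewrite expr0; apply/matrixP=> i j; rewrite !mxE expr0.
rewrite exprS IHk -mulmxE mulmx_diag; congr diag_mx.
by apply/rowP=> j; rewrite !mxE exprS.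
Qed.

Lemma diag_mx_unitary (C : numClosedFieldType) n (v : 'rV[C]_n) :
  (forall j, v 0 j * (v 0 j)^*%R = 1) -> diag_mx v \is unitarymx.
Proof.
move=> v1; apply/unitarymxP; rewrite tr_diag_mx map_diag_mx mulmx_diag.
by apply/matrixP=> i j; rewrite !mxE v1.
Qed.

(** * Roots of unity, character sums and a quadratic Gauss sum *)

Lemma unity_root_conj (C : numClosedFieldType) d (w : C) :
  (0 < d)%N -> w ^+ d = 1 -> w^*%R = w^-1.
Proof.
move=> d_gt0 wd1; rewrite invC_norm.
have /eqP-> : `|w| == 1 by rewrite -(pexpr_eq1 d_gt0) // -normrX wd1 normr1.
by rewrite expr1n invr1 mul1r.
Qed.

Lemma sum_unity_root (F : fieldType) d (z : F) :
  z ^+ d = 1 -> \sum_(j < d) z ^+ j = if z == 1 then d%:R else 0.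
Proof.
move=> zd1; case: eqP => [-> | /eqP z_neq1].
  by under eq_bigr do rewrite expr1n; rewrite sumr_const card_ord.
apply: (mulfI (x := z - 1)); first by rewrite subr_eq0.
by rewrite -subrX1 zd1 subrr mulr0.
Qed.

Section RootOfUnity.

Variables (C : numClosedFieldType) (d : nat) (w : C).
Hypothesis w_prim : d.-primitive_root w.

Let d_gt0 : (0 < d)%N := prim_order_gt0 w_prim.
Let w_neq0 : w != 0.
Proof. by rewrite (prim_root_eq0 w_prim) -lt0n. Qed.

Lemma prim_root_conjX n : (w ^+ n)^*%R = w ^- n.
Proof.
by rewrite rmorphXn /= (unity_root_conj d_gt0 (prim_expr_order w_prim)) exprVn.
Qed.

Lemma prim_root_mulX_conj n : w ^+ n * (w ^+ n)^*%R = 1.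
Proof. by rewrite prim_root_conjX divff // expf_neq0. Qed.

(** Orthogonality of the characters of Z/d: a geometric sum of ratio [w ^+ m / w ^+ n]. It serves
    both the unitarity of [P0] and the Gauss sum. *)
Lemma sum_prim_root (m n : nat) :
  \sum_(j < d) w ^+ (m * j) * w ^- (n * j) =
    if m == n %[mod d] then d%:R else 0.
Proof.
transitivity (\sum_(j < d) (w ^+ m / w ^+ n) ^+ j).
  by apply: eq_bigr => j _; rewrite !exprM exprMn exprVn.
rewrite sum_unity_root.
  rewrite -(eq_prim_root_expr w_prim) -subr_eq0 -[in RHS]subr_eq0.
  rewrite -(mulIr_eq0 _ (mulIf (expf_neq0 n w_neq0))) mulrBl mul1r divfK //.
  exact: expf_neq0.
rewrite exprMn exprVn -!exprM ![(_ * d)%N]mulnC !exprM (prim_expr_order w_prim).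
by rewrite !expr1n divr1.
Qed.

Hypothesis d_odd : odd d.

(** Replacing m by m + d adds d((d+1)/2 + m) to the exponent, and (d+1)/2 is an integer for odd d.
    This absorbs every wrap-around of indices below. *)
Lemma triangle_prim_modn n :
  w ^+ ((n %% d * (n %% d).+1) %/ 2) = w ^+ ((n * n.+1) %/ 2).
Proof.
have step m : w ^+ (((m + d) * (m + d).+1) %/ 2) = w ^+ ((m * m.+1) %/ 2).
  rewrite triangleD (triangle_odd d_odd) -addnA [(m * d)%N]mulnC.
  by rewrite -mulnDr exprD exprM (prim_expr_order w_prim) expr1n mulr1.
rewrite [in RHS](divn_eq n d) addnC; elim: (n %/ d)%N => [|a IHa].
  by rewrite mul0n addn0.
by rewrite mulSn addnCA addnC step.
Qed.

Lemma triangle_gauss_sum k : coprime d k ->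
  `| \sum_(j < d) w ^+ (k * ((j * j.+1) %/ 2)) | ^+ 2 = d%:R.
Proof.
move=> co_dk; rewrite normCK rmorph_sum /=.
(* The successor form gives the index type ['I_e.+1] its addition modulo d, needed for the shift by
   l. *)
have [e de] : exists e, d = e.+1 by exists d.-1; rewrite prednK.
pose t n := w ^+ (k * ((n * n.+1) %/ 2)).
have tD (l m : nat) : t ((l + m) %% e.+1)%N = t l * t m * w ^+ (k * m * l).
  rewrite -de /t mulnC exprM triangle_prim_modn -exprM triangleD mulnC.
  by rewrite !mulnDr !exprD [(l * m)%N]mulnC mulnA.
rewrite de mulrC big_distrlr /=.
transitivity (\sum_(l < e.+1) \sum_(m < e.+1) t m * w ^+ (k * m * l)).
  apply: eq_bigr => l _; rewrite (reindex_inj (addrI l)) /=.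
  apply: eq_bigr => m _; rewrite -[X in _ * X]/(t ((l + m) %% e.+1)%N) tD.
  by rewrite prim_root_conjX -/(t l) -mulrA mulKf // expf_neq0.
rewrite exchange_big /= (bigD1 ord0) //= [X in _ + X]big1 => [|m m_neq0].
  rewrite -[RHS]mulr1.
  under eq_bigr do rewrite muln0 mul0n expr0 mulr1.
  by rewrite sumr_const card_ord addr0 /t mul0n div0n muln0 expr0 mulr1.
rewrite -mulr_sumr.
have := sum_prim_root (k * m) 0.
under eq_bigr do rewrite mul0n expr0 invr1 mulr1.
rewrite de => ->; rewrite de in co_dk.
(* As k is coprime to d, d | km would force d | m, impossible for 0 < m < d; the sum over l is
   therefore 0. *)
by rewrite mod0n -[_ == 0%N]/(_ %| _)%N Gauss_dvdr // gtnNdvd ?mulr0 ?lt0n.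
Qed.

End RootOfUnity.

(** * The number exp(2 i pi / d) as a primitive root of unity *)

Lemma cos_neq1 (R : realType) (x : R) : 0 < x < pi *+ 2 -> cos x != 1.
Proof.
move=> /andP[x_gt0 x_lt2pi].
(* Since cos x = 1 - 2 sin(x/2)^2, it suffices that sin(x/2) is nonzero. *)
have /lt0r_neq0 sin_neq0 : 0 < sin (x / 2) by apply: sin_gt0_pi; lra.
have -> : x = x / 2 *+ 2 by rewrite mulr2n; lra.
apply: contra_neq sin_neq0; rewrite cos_mulr2n => cos1.
by apply/eqP; rewrite -sqrf_eq0 sin2cos2; apply/eqP; lra.
Qed.

Lemma expr_cis (R : realType) (x : R) n :
  (cos x +i* sin x) ^+ n = cos (x *+ n) +i* sin (x *+ n).
Proof.
elim: n => [|n IHn]; first by rewrite expr0 mulr0n cos0 sin0.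
by rewrite exprS IHn mulrS cosD sinD [sin x * _ + _]addrC.
Qed.

Lemma qE (R : realType) d :
  q R d = cos (pi *+ 2 / d%:R) +i* sin (pi *+ 2 / d%:R).
Proof.
have -> : q R d = Cexp (0 +i* (pi *+ 2 / d%:R)).
  rewrite /q; congr Cexp.
  have -> : 2 * 'i%C * (pi : R)%:C / d%:R = 'i%C * (pi *+ 2 / d%:R : R)%:C.
    rewrite -[pi *+ 2]mulr_natl !rmorphM fmorphV !rmorph_nat /=.
    by rewrite [2 * _]mulrC !mulrA.
  apply/eqP; rewrite eq_complex /=.
  by rewrite !(mul0r, mulr0, mul1r, subr0, oppr0, add0r) !eqxx.
by rewrite /Cexp expR0 mul1r.
Qed.

(** The order m of [q] divides d. If m < d, the angle 2 pi m / d lies strictly between 0 and 2 pi,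
    yet its cosine, the real part of [q ^+ m], would be 1. *)
Lemma q_primitive (R : realType) d : (0 < d)%N -> d.-primitive_root (q R d).
Proof.
move=> d_gt0; have d_neq0 : d%:R != 0 :> R by rewrite pnatr_eq0 -lt0n.
have qd1 : q R d ^+ d = 1.
  rewrite qE expr_cis -[_ / _ *+ d]mulr_natr divfK //.
  by rewrite cos2pi sin_mulr2n sinpi mulr0 mul0rn.
have [m q_prim m_dvd_d] := prim_order_exists d_gt0 qd1.
suff dm : m = d by rewrite dm in q_prim.
apply/eqP; rewrite eqn_leq dvdn_leq //= leqNgt; apply/negP => m_lt_d.
have := prim_expr_order q_prim; rewrite qE expr_cis => -[/eqP + _]; apply/negP.
have m_gt0 := prim_order_gt0 q_prim.
have pi2_gt0 : 0 < pi *+ 2 :> R by rewrite pmulrn_lgt0 ?pi_gt0.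
apply: cos_neq1; rewrite -[_ / _ *+ m]mulr_natr mulrAC; apply/andP; split.
  by rewrite divr_gt0 ?mulr_gt0 ?ltr0n.
by rewrite ltr_pdivrMr ?ltr0n // ltr_pM2l ?ltr_nat.
Qed.

Lemma sqrtd_sqr (R : realType) d : sqrtd R d ^+ 2 = d%:R.
Proof. by rewrite /sqrtd -rmorphXn /= sqr_sqrtr ?ler0n // rmorph_nat. Qed.

Lemma sqrtd_ge0 (R : realType) d : 0 <= sqrtd R d.
Proof. by rewrite /sqrtd ler0c sqrtr_ge0. Qed.

(** * The shift V, the diagonal D and the Fourier matrix P_0 *)

Section WeylMatrices.

Variables (R : realType) (d : nat).
Hypothesis d_odd : odd d.

Let d_gt0 : (0 < d)%N := odd_gt0 d_odd.
Let q_prim : d.-primitive_root (q R d) := q_primitive R d_gt0.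
Let qX_neq0 n : q R d ^+ n != 0.
Proof. by rewrite expf_neq0 // (prim_root_eq0 q_prim) -lt0n. Qed.

(** The cyclic successor [ordS] wraps d - 1 to 0, merging the corner entry with the
    superdiagonal. *)
Lemma VE (i j : 'I_d) : V R d i j = (j == ordS i)%:R.
Proof.
rewrite mxE -val_eqE /=; case: (ltngtP i.+1 d) => [id | | id].
- by rewrite orbF modn_small //; case: eqP.
- by rewrite ltnS leqNgt ltn_ord.
by rewrite id modnn (ltn_eqF (ltn_ord j)) /=; case: eqP.
Qed.

Lemma VMl (A : 'M[R[i]]_d) i k : (V R d *m A) i k = A (ordS i) k.
Proof.
rewrite mxE (bigD1 (ordS i)) //= VE eqxx mul1r big1 ?addr0 // => j j_neq.
by rewrite VE (negPf j_neq) mul0r.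
Qed.

Lemma DX k :
  D R d ^+ k = diag_mx (\row_(j < d) q R d ^+ (k * ((j * j.+1) %/ 2))).
Proof.
rewrite diag_mxX; congr diag_mx; apply/rowP=> j.
by rewrite !mxE -exprM mulnC.
Qed.

Lemma D_unitary : D R d \is unitarymx.
Proof.
by apply: diag_mx_unitary => j; rewrite mxE;
  apply: prim_root_mulX_conj q_prim _.
Qed.

Lemma invDX k : invmx (D R d) ^+ k =
  diag_mx (\row_(j < d) q R d ^- (k * ((j * j.+1) %/ 2))).
Proof.
rewrite invmx_unitary ?D_unitary // tr_diag_mx map_diag_mx diag_mxX.
congr diag_mx; apply/rowP=> j.
by rewrite !mxE /= (prim_root_conjX q_prim) exprVn -exprM mulnC.
Qed.

Lemma invDX_unitary k : invmx (D R d) ^+ k \is unitarymx.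
Proof.
rewrite invDX; apply: diag_mx_unitary => j; rewrite mxE.
rewrite -(prim_root_conjX q_prim) conjCK mulrC.
exact: prim_root_mulX_conj q_prim _.
Qed.

Lemma P0_unitary : P0 R d \is unitarymx.
Proof.
have s_real : ((sqrtd R d)^-1)^*%R = (sqrtd R d)^-1.
  by rewrite geC0_conj // invr_ge0 sqrtd_ge0.
apply/unitarymxP/matrixP=> i k; rewrite !mxE.
transitivity (\sum_(j < d) (sqrtd R d)^-1 ^+ 2 *
    (q R d ^+ (i * j) * q R d ^- (k * j))).
  apply: eq_bigr => j _; rewrite !mxE rmorphM /= s_real (prim_root_conjX q_prim).
  by rewrite mulrACA.
rewrite -mulr_sumr (sum_prim_root q_prim) exprVn sqrtd_sqr !modn_small //.
rewrite val_eqE; case: (i == k); last by rewrite mulr0.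
by rewrite mulVf // pnatr_eq0 -lt0n.
Qed.

Lemma Pk_unitary (k : 'I_d) : Pk R k \is unitarymx.
Proof. exact: mul_unitarymx (invDX_unitary k) P0_unitary. Qed.

(* Oddness of d is needed only at the corner entry of V_k. *)
Lemma Vk_invDX (k : 'I_d) :
  Vk R k *m invmx (D R d) ^+ k = invmx (D R d) ^+ k *m V R d.
Proof.
rewrite /Vk -mulmxA invDX /U diag_mxX mulmx_diag mul_diag_mx mul_mx_diag.
apply/matrixP=> i j; rewrite !mxE.
have := VE i j; rewrite mxE => ->.
case: eqP => [-> | _]; last by rewrite !(mul0r, mulr0).
rewrite mul1r mulr1 -exprM.
(* The recurrence t(i+1) = t(i) q^(i+1), with i + 1 reduced modulo d, is exactly the comparison of
   the entries at (i, i+1). *)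
have T : q R d ^+ ((ordS i * (ordS i).+1) %/ 2) =
         q R d ^+ ((i * i.+1) %/ 2) * q R d ^+ ordS i.
  rewrite /= (triangle_prim_modn q_prim d_odd) (prim_expr_mod q_prim) -exprD.
  by rewrite -(addn1 i) triangleD muln1 addnAC -addnA addn1.
rewrite ![(k * _)%N]mulnC !exprM T exprMn mulrC invfM mulfVK //.
by rewrite -exprM.
Qed.

Lemma V_P0 : V R d *m P0 R d = P0 R d *m U R d.
Proof.
apply/matrixP=> i k; rewrite VMl mul_mx_diag !mxE -mulrA -exprD.
(* Taking the power k last exposes q^((i+1) mod d), whose reduction modulo d can then be dropped. *)
rewrite /= ![(_ * k)%N]mulnC -mulnSr !(exprM _ k) !(exprAC _ k).
by rewrite (prim_expr_mod q_prim).
Qed.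

Lemma Vk_Pk (k : 'I_d) : Vk R k *m Pk R k = Pk R k *m U R d.
Proof. by rewrite mulmxA Vk_invDX -!mulmxA V_P0. Qed.

Lemma Pk_conj (k : 'I_d) : (Pk R k)^t* *m Vk R k *m Pk R k = U R d.
Proof.
rewrite -mulmxA Vk_Pk mulmxA.
(* Unitarity is stated as P P^* = 1; [mulmx1C] gives the other order. *)
by rewrite (mulmx1C (unitarymxP (Pk_unitary k))) mul1mx.
Qed.

Lemma Pk_adjE (k i j : 'I_d) : ((Pk R k)^t*) i j =
  (sqrtd R d)^-1 * q R d ^- (i * j) * q R d ^+ (k * ((j * j.+1) %/ 2)).
Proof.
rewrite /Pk invDX mul_diag_mx !mxE !rmorphM /= -(prim_root_conjX q_prim) conjCK.
rewrite (prim_root_conjX q_prim) geC0_conj ?invr_ge0 ?sqrtd_ge0 //.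
by rewrite mulrC (mulnC j).
Qed.

(** [P0] is symmetric, so column j of its adjoint is the conjugate of v_j, which is v_(d-j); the
    factor D^k on the right rescales the columns. The congruence covers j = 0, where d - j is not an
    index and l = 0. *)
Lemma col_Pk_adj (k j l : 'I_d) : l = (d - j)%N %[mod d] ->
  col j ((Pk R k)^t*) =
    q R d ^+ (k * ((j * j.+1) %/ 2)) *: col l (P0 R d).
Proof.
move=> lj; apply/colP=> i; rewrite [LHS]mxE Pk_adjE !mxE mulrC.
congr (_ * (_ * _)); rewrite ![(i * _)%N]mulnC !(exprM _ _ i) -exprVn.
congr (_ ^+ _).
have /eqP -> : q R d ^+ l == q R d ^+ (d - j).
  by rewrite (eq_prim_root_expr q_prim) lj.
rewrite exprB ?(ltnW (ltn_ord j)) ?(prim_expr_order q_prim) ?mul1r //.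
by rewrite unitfE (prim_root_eq0 q_prim) -lt0n.
Qed.

Lemma q_triangle_pred : q R d ^+ ((d.-1 * d.-1.+1) %/ 2) = 1.
Proof. by rewrite triangle_pred // exprM (prim_expr_order q_prim) expr1n. Qed.

End WeylMatrices.

Theorem theorem2p11 (R : realType) (d : nat) (d_odd : odd d) :
  (* D is unitary, and its last diagonal entry is 1 *)
  [/\ D R d \is unitarymx
    & forall j : 'I_d, j.+1 = d -> D R d j j = 1] /\
  [/\ (* (i) *)
      forall k : 'I_d, unitarily_equivalent (Vk R k) (U R d),
      (* (ii) *)
      forall k : 'I_d,
        [/\ (Pk R k)^t* *m Vk R k *m Pk R k = U R d,
            (* column j of P_k^* is q^(k j(j+1)/2) v_(d-j), with v_d = v_0 *)
            forall j l : 'I_d, l = (d - j)%N %[mod d] ->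
              col j ((Pk R k)^t*) =
                q R d ^+ (k * ((j * j.+1) %/ 2)) *: col l (P0 R d)
          & (* the last column of P_k^* is v_1 *)
            forall j l : 'I_d, j.+1 = d -> l = 1%N %[mod d] ->
              col j ((Pk R k)^t*) = col l (P0 R d)]
    & (* (iii) *)
      forall k : 'I_d, coprime d k ->
        `| \tr (D R d ^+ k) | = sqrtd R d].
Proof.
have d_gt0 := odd_gt0 d_odd; have q_prim := q_primitive R d_gt0.
have q_last (j : 'I_d) : j.+1 = d -> q R d ^+ ((j * j.+1) %/ 2) = 1.
  by move=> jd; rewrite -(q_triangle_pred R d_odd) -(congr1 predn jd).
split; first split.
- exact: D_unitary.
- by move=> j jd; rewrite !mxE eqxx mulr1n q_last.
split=> [k | k | k co_dk].
- by exists (Pk R k); [apply: Pk_unitary | apply: Pk_conj].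
- split=> [|j l|j l jd l1]; [exact: Pk_conj | exact: col_Pk_adj |].
  (* The scalar is 1 at the last index, so the claim is the case d - j = 1 of the general column
     formula. *)
  have -> : col l (P0 R d) =
      q R d ^+ (k * ((j * j.+1) %/ 2)) *: col l (P0 R d).
    by rewrite mulnC exprM q_last // expr1n scale1r.
  by apply: col_Pk_adj => //; have -> : (d - j = 1)%N by lia.
rewrite DX mxtrace_diag; under eq_bigr do rewrite mxE.
(* Both sides are nonnegative, so comparing squares suffices. *)
apply/eqP; rewrite -(@eqrXn2 _ 2) ?normr_ge0 ?sqrtd_ge0 //.
by rewrite (triangle_gauss_sum q_prim) // sqrtd_sqr.
Qed.
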